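(* Let $k\ge 1$ and $n>k+1$ be integers. Then $$ \frac{\tau_{n,k}}{\tau_{n+1,k}}\leq \frac{(n+k)(n+k-2)\cdots(n-k+2)}{(n+k-1)(n+k-3)\cdots(n-k+1)}. $$
   Context: $T_n$ is the $n$-th Chebyshev polynomial of the first kind, $T_n(\cos\theta)=\cos n\theta$, and $T_n^{(k)}$ is its $k$-th derivative. For integers $k\ge1$ and $n\geq k+2$, $\omega_{n,k}$ denotes the largest (rightmost) zero of the polynomial $T_n^{(k+1)}$ (all of whose zeros are real and lie in $(-1,1)$), and $$\tau_{n,k}:=\frac{|T_n^{(k)}(\omega_{n,k})|}{T_n^{(k)}(1)}.$$ The products in the numerator and the denominator each have $k$ factors decreasing in steps of $2$: $(n+k)(n+k-2)\cdots(n-k+2)=\prod_{j=1}^{k}(n+k+2-2j)$ and $(n+k-1)(n+k-3)\cdots(n-k+1)=\prod_{j=1}^{k}(n+k+1-2j)$. *)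

(* Defs.v *)
From HB Require Import structures.
From mathcomp Require Import all_boot all_order all_algebra.
From mathcomp Require Import ring.
From mathcomp Require Import all_classical all_reals all_analysis.

Set Implicit Arguments.
Unset Strict Implicit.
Unset Printing Implicit Defensive.

Import Order.TTheory GRing.Theory Num.Theory.

Local Open Scope classical_set_scope.
Local Open Scope ring_scope.

Fixpoint chebT (R : realType) (n : nat) : {poly R} :=
  match n with
  | 0 => 1
  | m.+1 => match m with
            | 0 => 'X
            | l.+1 => 2%:P * 'X * chebT R m - chebT R l
            end
  end.

Lemma chebT_cos (R : realType) (n : nat) (theta : R) :
  (chebT R n).[cos theta] = cos (n%:R * theta).
Proof.
suff: (chebT R n).[cos theta] = cos (n%:R * theta) /\
      (chebT R n.+1).[cos theta] = cos (n.+1%:R * theta) by case.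
elim: n => [|n [IH0 IH1]].
  by rewrite /= mul0r cos0 mul1r hornerC hornerX.
split=> //.
have -> : chebT R n.+2 = 2%:P * 'X * chebT R n.+1 - chebT R n by [].
rewrite hornerD hornerN !hornerM hornerC hornerX IH0 IH1.
have -> : n.+2%:R * theta = n.+1%:R * theta + theta by rewrite -natr1 mulrDl mul1r.
have -> : n%:R * theta = n.+1%:R * theta - theta
  by rewrite -natr1 mulrDl mul1r addrK.
by rewrite cosB cosD; ring.
Qed.

Definition largest_zero (R : realType) (p : {poly R}) (x : R) : Prop :=
  root p x /\ forall y, root p y -> y <= x.

(* The default value 0 of xget is irrelevant when 1 <= k and k + 2 <= n,
   since a largest zero then exists, and it is always unique. *)
Definition omega (R : realType) (n k : nat) : R :=
  xget 0 [set x : R | largest_zero (chebT R n)^`(k.+1) x].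

Definition tau (R : realType) (n k : nat) : R :=
  `|(chebT R n)^`(k).[omega R n k]| / (chebT R n)^`(k).[1].

(* Main.v *)
Require Import Defs.
From HB Require Import structures.
From mathcomp Require Import all_boot all_order all_algebra.
From mathcomp Require Import ring lra.
From mathcomp Require Import polyrcf.
From mathcomp Require Import all_classical all_reals all_analysis.

(** Write [p_n = T_n^(k) / T_n^(k)(1)] and [w = omega_n].  The contiguous
    relations between [T_n^(k)], [T_n^(k+1)], [T_(n+1)^(k)], [T_(n+1)^(k+1)] give
    [p_(n+1)(w) = w p_n(w)] and [p_(n+1)'(w) = (n+1-k) p_n(w)].  As
    [p_n(w) <= 0], the second equality shows [omega_n <= omega_(n+1)].  Sonin's
    function [((n+1)^2 - k^2) p_(n+1)^2 + (1 - x^2) p_(n+1)'^2] is nondecreasing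
    for [x >= 0]; comparing its values at [omega_n] and [omega_(n+1)] yields
    [(n+1-k) tau_n^2 <= (n+1+k) tau_(n+1)^2], and [(n+1+k) / (n+1-k)] is at most
    the square of the quotient of products by AM-GM and telescoping. *)

Import Order.TTheory GRing.Theory Num.Theory.
Local Open Scope ring_scope.

(** * Contiguous relations and differential equation for [T_n^(k)] *)

Section ChebyshevIdentities.
Context {R : realType}.
Implicit Types n k : nat.

Local Notation T n := (chebT R n).
Local Notation "'D[' k ] n" := ((chebT R n)^`(k)) (at level 10).

Lemma deriv_natr (m : nat) : (m%:R : {poly R})^`() = 0.
Proof. by rewrite -polyC_natr derivC. Qed.

Lemma deriv_poly1 : (1 : {poly R})^`() = 0.
Proof. exact: (deriv_natr 1). Qed.

Let dE := (derivM, derivD, derivB, derivN, derivX, deriv_natr, deriv_poly1).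

Lemma chebTSS n : T n.+2 = 2 * 'X * T n.+1 - T n.
Proof. by rewrite /= -(polyC_natr _ 2). Qed.

(** The relations are proved as a pair because the recurrence for [T n.+2] brings in the derivatives
    of both predecessors. *)
Lemma chebT_derivE n :
  (1 - 'X * 'X) * (T n)^`() = n%:R * ('X * T n - T n.+1) /\
  (1 - 'X * 'X) * (T n.+1)^`() = n.+1%:R * (T n - 'X * T n.+1).
Proof.
elim: n => [|n [IHn IHSn]].
  by split; rewrite /= ?dE; ring.
split; first by rewrite IHSn chebTSS; ring.
rewrite chebTSS !dE.
transitivity (2 * (1 - 'X * 'X) * T n.+1
    + 2 * 'X * ((1 - 'X * 'X) * (T n.+1)^`()) - (1 - 'X * 'X) * (T n)^`());
  first by ring.
by rewrite IHn IHSn; ring.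
Qed.

(** Turns the subtraction of one polynomial equation from another into a single [ring] check. *)
Lemma eq_of_sub {a b c d x y : {poly R}} :
  a = b -> c = d -> x - y = (a - b) - (c - d) -> x = y.
Proof. by move=> -> ->; rewrite !subrr => /subr0_eq. Qed.

Lemma oneBX2_neq0 : (1 - 'X * 'X : {poly R}) != 0.
Proof.
apply/eqP => /(congr1 (fun p => p.[0])) /eqP.
by rewrite /= !hornerE subr0 oner_eq0.
Qed.

(** For [k = 0], combine the relations of [chebT_derivE] and cancel [1 - X^2]; differentiation then
    raises [k]. *)
Lemma derivn_chebT_up n k :
  n%:R * D[k.+1] n.+1 =
  n.+1%:R * ('X * D[k.+1] n + (n + k)%:R * D[k] n).
Proof.
elim: k => [|k IHk].
  rewrite derivn0 addn0; apply: (mulfI oneBX2_neq0).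
  have [E1 E2] := chebT_derivE n.
  transitivity (n%:R * ((1 - 'X * 'X) * (T n.+1)^`())); first by rewrite derivn1; ring.
  transitivity (n.+1%:R * ('X * ((1 - 'X * 'X) * (T n)^`())
                           + (1 - 'X * 'X) * (n%:R * T n))); last by rewrite derivn1; ring.
  rewrite E1 E2; ring.
have := congr1 (@deriv R) IHk.
rewrite !dE -!derivnS => E.
rewrite !(mul0r, mul1r, add0r) in E.
rewrite E; ring.
Qed.

(** Differentiating the relation for [k] leaves a term in [D[k] n], which [derivn_chebT_up]
    eliminates. *)
Lemma derivn_chebT_down n k :
  n.+1%:R * ((1 - 'X * 'X) * D[k.+1] n) =
  n.+1%:R * (n + k)%:R * 'X * D[k] n - n%:R * (n.+1%:R - k%:R) * D[k] n.+1.
Proof.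
elim: k => [|k IHk].
  by rewrite derivn1 (chebT_derivE n).1 !derivn0 addn0; ring.
have := congr1 (@deriv R) IHk.
rewrite !dE -!derivnS.
set a := D[k.+2] n; set b := D[k.+1] n; set c := D[k] n.
move=> E; have := derivn_chebT_up n k; rewrite -/b -/c => F.
by apply: (eq_of_sub E F); ring.
Qed.

Lemma derivn_chebT_ode n k :
  (1 - 'X * 'X) * D[k.+2] n - (2 * k + 1)%:R * 'X * D[k.+1] n
    + (n%:R ^+ 2 - k%:R ^+ 2) * D[k] n = 0.
Proof.
elim: k => [|k IHk].
  have := congr1 (@deriv R) (chebT_derivE n).1.
  rewrite !dE -[(T n)^`()]derivn1 -[(T n.+1)^`()]derivn1 -derivnS.
  have := derivn_chebT_up n 0; rewrite !derivn0 addn0.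
  by move=> F E; apply: (eq_of_sub E F); ring.
have := congr1 (@deriv R) IHk.
rewrite !dE -!derivnS.
rewrite deriv0 => <-; ring.
Qed.

End ChebyshevIdentities.

(** * Largest zeros of real polynomials *)

Section LargestZero.
Context {R : realType}.
Implicit Types p : {poly R}.

Lemma ex_largest_zero p x : p != 0 -> root p x -> exists w, largest_zero p w.
Proof.
have [m] := ubnP (size p); elim: m => // m IHm in p x *.
move=> lpm p0 /factor_theorem[q pE].
have q0 : q != 0 by apply: contraNneq p0 => q0; rewrite pE q0 mul0r.
have rE y : root p y = root q y || (y == x).
  by rewrite pE rootM root_XsubC.
case: (pselect (exists y, root q y)) => [[y qy]|nq].
  have [|w [qw wmax]] := IHm q y _ q0 qy.
    by move: lpm; rewrite pE size_Mmonic ?monicXsubC// size_XsubC addn2.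
  exists (Num.max w x); split=> [|z]; rewrite rE.
    by rewrite /Num.max; case: ifP => _; rewrite ?eqxx ?qw ?orbT.
  by move=> /orP[/wmax|/eqP->]; rewrite le_max ?lexx ?orbT// => ->.
exists x; split=> [|z]; rewrite rE; first by rewrite eqxx orbT.
by move=> /orP[qz|/eqP->//]; case: nq; exists z.
Qed.

Lemma largest_zero_gt p w y z : largest_zero p w -> w < y -> y <= z ->
  0 < p.[z] -> 0 < p.[y].
Proof.
move=> [_ wmax] wy yz pz; rewrite ltNge; apply/negP => py.
have [|c] := @poly_ivt _ p y z yz; first by rewrite py ltW.
by move=> /andP[yc _] /wmax; rewrite leNgt (lt_le_trans wy yc).
Qed.

(** With [p = (X - w) q] one has [p'(w) = q(w)]; were this negative, [q] would vanish between [w]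
    and [z], against the maximality of [w]. *)
Lemma largest_zero_deriv_ge0 p w z : largest_zero p w -> w < z ->
  0 < p.[z] -> 0 <= p^`().[w].
Proof.
move=> lw wz pz; have [/factor_theorem[q pE] wmax] := lw.
rewrite pE derivM derivXsubC !hornerE subrr mulr0 add0r leNgt.
have qz : 0 < q.[z].
  by move: pz; rewrite pE !hornerE pmulr_lgt0 // subr_gt0.
apply/negP => qw.
have [|c] := @poly_ivtoo _ q w z (ltW wz); first by rewrite nmulr_rlt0.
rewrite in_itv /= => /andP[wc _] qc.
by have := wmax c; rewrite pE rootM qc leNgt wc => /(_ isT).
Qed.

End LargestZero.

(** * Signs of the derivatives and location of [omega] *)

Section ChebyshevDerivatives.
Context {R : realType}.
Implicit Types (n k : nat) (x w : R).

Local Notation T n := (chebT R n).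
Local Notation "'D[' k ] n" := ((chebT R n)^`(k)) (at level 10).

Lemma derivn_chebT_upE n k x :
  n%:R * (D[k.+1] n.+1).[x] =
  n.+1%:R * (x * (D[k.+1] n).[x] + (n + k)%:R * (D[k] n).[x]).
Proof.
have := congr1 (horner^~ x) (derivn_chebT_up (R := R) n k).
by rewrite -!polyC_natr !hornerE.
Qed.

Lemma derivn_chebT_downE n k x :
  n.+1%:R * ((1 - x * x) * (D[k.+1] n).[x]) =
  n.+1%:R * (n + k)%:R * x * (D[k] n).[x]
    - n%:R * (n.+1%:R - k%:R) * (D[k] n.+1).[x].
Proof.
have := congr1 (horner^~ x) (derivn_chebT_down (R := R) n k).
by rewrite -!polyC_natr -!polyCB !hornerE.
Qed.

Lemma derivn_chebT_odeE n k x :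
  (1 - x * x) * (D[k.+2] n).[x] - (2 * k + 1)%:R * x * (D[k.+1] n).[x]
    + (n%:R ^+ 2 - k%:R ^+ 2) * (D[k] n).[x] = 0.
Proof.
have := congr1 (horner^~ x) (derivn_chebT_ode (R := R) n k).
by rewrite -!polyC_natr -!polyC_exp -!polyCB !hornerE.
Qed.

Lemma chebT_ge1 n x : 1 <= x -> 1 <= (T n).[x].
Proof.
move=> x1; suff: 1 <= (T n).[x] <= (T n.+1).[x] by case/andP.
elim: n => [|n /andP[IH1 IH2]]; first by rewrite /= !hornerE lexx.
apply/andP; split; first exact: le_trans IH2.
rewrite chebTSS -polyC_natr !hornerE; nra.
Qed.

Lemma derivn_chebT_gt0 n k x : 1 <= x -> (k <= n)%N -> 0 < (D[k] n).[x].
Proof.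
(* Nonnegativity for every [k] is carried along: the top derivative of [T n.+1] is reached through
   [D[n.+1] n], which vanishes. *)
move=> x1 kn; suff /(_ k)[_ ->//] : forall k,
  0 <= (D[k] n).[x] /\ ((k <= n)%N -> 0 < (D[k] n).[x]).
have x0 : 0 < x by exact: lt_le_trans x1.
elim: n {k kn} => [[|k]|n IHn [|k]].
- by rewrite derivn0 hornerE.
- by rewrite derivSn deriv_poly1 derivn_poly0 ?size_poly0 // horner0.
- have Tgt0 := lt_le_trans ltr01 (chebT_ge1 n.+1 x x1).
  by rewrite derivn0; split=> // ; exact: ltW.
have [n0|n_gt0] := posnP n.
  rewrite n0 derivSn /= derivX; case: k => [|k]; first by rewrite hornerE.
  by rewrite derivSn deriv_poly1 derivn_poly0 ?size_poly0 // horner0.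
have [IHk IHk'] := IHn k; have [IHSk _] := IHn k.+1.
have n0 : 0 < n%:R :> R by rewrite ltr0n.
have nk0 : 0 < (n + k)%:R :> R by rewrite ltr0n addn_gt0 n_gt0.
have E := derivn_chebT_upE n k x; split=> [|kn].
  by rewrite -(pmulr_rge0 _ n0) E mulr_ge0 // addr_ge0 // mulr_ge0 // ltW.
rewrite -(pmulr_rgt0 _ n0) E mulr_gt0 // ltr_wpDl //.
  by rewrite mulr_ge0 // ltW.
by rewrite mulr_gt0 // IHk'.
Qed.

(** At [w] the middle term of the differential equation drops out, so [D[k] n] has the sign opposite
    to [D[k.+2] n], which is nonnegative there since [D[k.+1] n] is positive at [1]. *)
Lemma derivn_chebT_largest_zero_le0 n k w : (k < n)%N ->
  largest_zero (D[k.+1] n) w -> 0 <= w < 1 -> (D[k] n).[w] <= 0.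
Proof.
move=> kn lw /andP[w0 w1].
have D2 : 0 <= (D[k.+2] n).[w].
  by rewrite derivnS (largest_zero_deriv_ge0 _ _ _ lw w1) // derivn_chebT_gt0.
have := derivn_chebT_odeE n k w; rewrite (rootP lw.1) mulr0 subr0.
have nk : 0 < n%:R ^+ 2 - k%:R ^+ 2 :> R.
  by rewrite subr_gt0 -!natrX ltr_nat ltn_sqr.
have ww : 0 <= 1 - w * w by nra.
move/eqP; rewrite addr_eq0 => /eqP E.
by rewrite -(pmulr_rle0 _ nk) -oppr_ge0 -E mulr_ge0.
Qed.

Lemma derivn_chebT_succ_root0 k : (D[k] k.+1).[0 : R] = 0.
Proof.
elim: k => [|k IHk]; first by rewrite derivn0 /= hornerX.
have := derivn_chebT_upE k.+1 k 0; rewrite IHk mul0r mulr0 addr0 mulr0.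
by move/eqP; rewrite mulf_eq0 pnatr_eq0 /= => /eqP.
Qed.

(** Induction on [n] from the root [0] at [n = k + 2]: [D[k.+1] n.+1] is nonpositive at [omega_n]
    and positive at [1], hence has a root in between. Any nonnegative root ensures that [xget]
    returns a true largest zero. *)
Lemma omegaP n k : (k.+1 < n)%N ->
  largest_zero (D[k.+1] n) (omega R n k) /\ 0 <= omega R n k < 1.
Proof.
have of_root m x : (k.+1 < m)%N -> root (D[k.+1] m) x -> 0 <= x ->
    largest_zero (D[k.+1] m) (omega R m k) /\ 0 <= omega R m k < 1.
  move=> km rx x0.
  have D_gt0 y : 1 <= y -> 0 < (D[k.+1] m).[y].
    by move=> y1; rewrite derivn_chebT_gt0 // ltnW.
  have D0 : D[k.+1] m != 0.
    by apply: contraTneq (D_gt0 1 (lexx _)) => ->; rewrite horner0 ltxx.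
  have lw : largest_zero (D[k.+1] m) (omega R m k).
    exact: xgetPex (ex_largest_zero _ _ D0 rx).
  split=> //; rewrite (le_trans x0 (lw.2 _ rx)) /= ltNge.
  by apply/negP => /D_gt0; rewrite (rootP lw.1) ltxx.
elim: n => // n IHn; rewrite ltnS leq_eqVlt => /orP[/eqP <-|kn].
  by apply: (of_root _ 0) => //; apply/rootP/derivn_chebT_succ_root0.
have [lw w01] := IHn kn; set w := omega R n k in lw w01.
have [w0 w1] := andP w01.
have Dw : (D[k.+1] n.+1).[w] <= 0.
  have n0 : 0 < n%:R :> R by rewrite ltr0n (leq_trans _ kn).
  rewrite -(pmulr_rle0 _ n0) derivn_chebT_upE (rootP lw.1) mulr0 add0r.
  rewrite mulr_ge0_le0 // mulr_ge0_le0 //.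
  by apply: derivn_chebT_largest_zero_le0 lw w01; exact: ltnW.
have D1 : 0 < (D[k.+1] n.+1).[1].
  by rewrite derivn_chebT_gt0 // ltnW // ltnW.
have [|c] := @poly_ivt _ (D[k.+1] n.+1) w 1 (ltW w1).
  by rewrite Dw ltW.
move=> /andP[wc _] rc; apply: (of_root _ c) => //; first exact: ltnW.
exact: le_trans wc.
Qed.

End ChebyshevDerivatives.

(** * Sonin's monotonicity and comparison of consecutive [tau] *)

Section Extrema.
Context {R : realType}.
Implicit Types (n k : nat) (x w : R).

Local Notation T n := (chebT R n).
Local Notation "'D[' k ] n" := ((chebT R n)^`(k)) (at level 10).

(* Sonin's function of the differential equation [derivn_chebT_ode]. *)
Definition sonin n k : {poly R} :=
  (n%:R ^+ 2 - k%:R ^+ 2) * (D[k] n * D[k] n)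
  + (1 - 'X * 'X) * (D[k.+1] n * D[k.+1] n).

(** The differential equation times [2 D[k.+1] n] removes the second-order term and leaves [x] times
    a square, whence [sonin_le]. *)
Lemma deriv_sonin n k :
  (sonin n k)^`() = (4 * k)%:R * 'X * (D[k.+1] n * D[k.+1] n).
Proof.
have := derivn_chebT_ode (R := R) n k.
rewrite /sonin !(derivD, derivB, derivN, derivM, derivX, deriv_natr, deriv_poly1) -!derivnS.
set a := D[k.+2] n; set b := D[k.+1] n; set c := D[k] n => E.
have {}E := congr1 ( *%R (2 * b)) E.
by apply: (eq_of_sub E (erefl 0)); ring.
Qed.

Lemma soninE n k x :
  (sonin n k).[x] = (n%:R ^+ 2 - k%:R ^+ 2) * (D[k] n).[x] ^+ 2
    + (1 - x ^+ 2) * (D[k.+1] n).[x] ^+ 2.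
Proof.
by rewrite /sonin -!polyC_natr -!polyC_exp -!polyCB !hornerE; ring.
Qed.

Lemma sonin_le n k (x y : R) : 0 <= x -> x <= y ->
  (sonin n k).[x] <= (sonin n k).[y].
Proof.
move=> x0; rewrite le_eqVlt => /orP[/eqP->//|xy].
have [c] := poly_mvt (sonin n k) xy; rewrite in_itv /= => /andP[xc _] E.
rewrite -subr_ge0 E deriv_sonin -polyC_natr !hornerE.
rewrite mulr_ge0 ?subr_ge0 ?(ltW xy) //.
rewrite /= -mulrA; apply: mulr_ge0; last by rewrite -expr2 sqr_ge0.
by rewrite mulr_ge0 // (le_trans x0 (ltW xc)).
Qed.

Lemma omega_le n k : (k.+1 < n)%N -> omega R n k <= omega R n.+1 k.
Proof.
move=> kn; have [lw w01] := omegaP (R := R) n k kn.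
have [lv _] := omegaP (R := R) n.+1 k (ltnW kn).
have n0 : 0 < n%:R :> R by rewrite ltr0n (leq_trans _ kn).
rewrite leNgt; apply/negP => vw.
have : 0 < (D[k.+1] n.+1).[omega R n k].
  apply: (largest_zero_gt _ _ _ 1 lv vw).
    by case/andP: w01 => _ /ltW.
  by rewrite derivn_chebT_gt0 // ltnW // ltnW.
rewrite -(pmulr_rgt0 _ n0) derivn_chebT_upE (rootP lw.1) mulr0 add0r.
rewrite ltNge mulr_ge0_le0 // mulr_ge0_le0 //.
by apply: derivn_chebT_largest_zero_le0 lw w01; exact: ltnW.
Qed.

Lemma tau_sqr_le n k : (k.+1 < n)%N ->
  (n.+1%:R - k%:R) * tau R n k ^+ 2 <= (n.+1%:R + k%:R) * tau R n.+1 k ^+ 2.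
Proof.
move=> kn; have [lw /andP[w0 w1]] := omegaP (R := R) n k kn.
have [lv _] := omegaP (R := R) n.+1 k (ltnW kn).
have := sonin_le n.+1 k _ _ w0 (omega_le n k kn).
rewrite !soninE (rootP lv.1) expr0n mulr0 addr0.
(* At [omega_n], where [D[k.+1] n] vanishes, these give [D[k] n.+1] and its derivative in terms of
   [D[k] n]; at [1] they link the two normalizing values. *)
have := derivn_chebT_upE n k (omega R n k).
have := derivn_chebT_downE n k (omega R n k).
have := derivn_chebT_downE n k (1 : R).
rewrite (rootP lw.1) !mulr0 add0r mulr1 subrr mul0r mulr0 mulr1.
rewrite /tau !expr_div_n !real_normK ?num_real //.
have U0 : 0 < (D[k] n).[1 : R] by rewrite derivn_chebT_gt0 // ltnW // ltnW.
have V0 : 0 < (D[k] n.+1).[1 : R].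
  by rewrite derivn_chebT_gt0 // ltnW // ltnW // ltnW.
move: U0 V0; set U := (D[k] n).[1]; set V := (D[k] n.+1).[1].
set u := (D[k] n).[_]; set v := (D[k] n.+1).[omega R n.+1 k].
set y := (D[k] n.+1).[_]; set y' := (D[k.+1] n.+1).[_].
move: (omega R n k) w0 w1 => w w0 w1 U0 V0.
have nk : (k%:R + 1 < n%:R :> R) by rewrite natr1 ltr_nat.
have k0 : (0 <= k%:R :> R) by [].
rewrite natrD -[n.+1%:R]natr1.
move: (n%:R : R) (k%:R : R) nk k0 => N K nk k0.
(* Scaling by [c] and [d] avoids divisions: [c U = d V] gives both [tau] a common denominator, and
   [d y = c w u]. *)
set c := (N + 1) * (N + K); set m := N + 1 - K; set d := N * m.
have c0 : 0 < c by rewrite /c mulr_gt0; lra.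
have m0 : 0 < m by rewrite /m; lra.
have d0 : 0 < d by rewrite /d mulr_gt0 //; lra.
move=> /esym/subr0_eq cU /esym/subr0_eq dy Ny' S.
have {}Ny' : d * y' = m * (c * u) by rewrite /d mulrAC Ny' /c; ring.
have {}S : ((N + 1 + K) * w ^+ 2 + (1 - w ^+ 2) * m) * (c * u) ^+ 2
    <= (N + 1 + K) * (d * v) ^+ 2.
  rewrite -(ler_pM2l m0).
  have -> : m * (((N + 1 + K) * w ^+ 2 + (1 - w ^+ 2) * m) * (c * u) ^+ 2)
    = ((N + 1) ^+ 2 - K ^+ 2) * (c * w * u) ^+ 2
      + (1 - w ^+ 2) * (m * (c * u)) ^+ 2 by rewrite /m; ring.
  have -> : m * ((N + 1 + K) * (d * v) ^+ 2)
    = d ^+ 2 * (((N + 1) ^+ 2 - K ^+ 2) * v ^+ 2) by rewrite /m; ring.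
  by rewrite dy -Ny'; have := ler_wpM2l (sqr_ge0 d) S; lra.
(* The bracket on the left of [S] equals [m + 2 K w^2], so it is at least [m]. *)
have {}S : m * (c * u) ^+ 2 <= (N + 1 + K) * (d * v) ^+ 2.
  apply: le_trans S; apply: ler_wpM2r; first exact: sqr_ge0.
  have : 0 <= K * w ^+ 2 by rewrite mulr_ge0 ?sqr_ge0.
  by rewrite /m; lra.
have -> : u ^+ 2 / U ^+ 2 = (c * u) ^+ 2 / (c * U) ^+ 2.
  by field; rewrite !gt_eqF.
have -> : v ^+ 2 / V ^+ 2 = (d * v) ^+ 2 / (d * V) ^+ 2.
  by field; rewrite !gt_eqF.
rewrite cU [leLHS]mulrA [leRHS]mulrA ler_pM2r //.
by rewrite invr_gt0 exprn_gt0 // mulr_gt0.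
Qed.

End Extrema.

(* AM-GM, [(z - 2 j) ^ 2 >= (z - 2 j + 1) (z - 2 j - 1)], telescopes. *)
Lemma prod_ratio_sqr_ge {R : realFieldType} (z : R) (k : nat) :
  2 * k%:R + 1 <= z ->
  (z - 1) * (\prod_(1 <= j < k.+1) (z - 1 - 2 * j%:R)) ^+ 2 <=
  (z - 1 - 2 * k%:R) * (\prod_(1 <= j < k.+1) (z - 2 * j%:R)) ^+ 2.
Proof.
elim: k => [|k IHk] kz; first by rewrite !big_geq // mulr0 subr0.
rewrite -natr1 in kz.
have {}IHk := IHk ltac:(lra).
rewrite !(@big_nat_recr _ _ _ k.+1) //= -[k.+1%:R]natr1.
set g := \prod_(_ <= _ < _) _ in IHk *; set f := \prod_(_ <= _ < _) _ in IHk *.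
set G := z - 1 - 2 * (k%:R + 1).
have GE : z - 2 * (k%:R + 1) = G + 1 by rewrite /G; ring.
have G0 : 0 <= G by rewrite /G; lra.
rewrite GE !exprMn mulrA.
apply: le_trans (ler_wpM2r (sqr_ge0 G) IHk) _.
have -> : z - 1 - 2 * k%:R = G + 2 by rewrite /G; ring.
have := mulr_ge0 (sqr_ge0 f) G0; nra.
Qed.

Theorem theorem1p5 (R : realType) (n k : nat) (hk : (1 <= k)%N)
    (hn : (k + 1 < n)%N) :
  tau R n k / tau R n.+1 k <=
    (\prod_(1 <= j < k.+1) (n%:R + k%:R + 2 - 2 * j%:R)) /
    (\prod_(1 <= j < k.+1) (n%:R + k%:R + 1 - 2 * j%:R)).
Proof.
have kn : (k.+1 < n)%N by rewrite -addn1.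
have nk : k%:R + 1 < n%:R :> R by rewrite natr1 ltr_nat.
have k0 : 0 <= k%:R :> R by [].
have := tau_sqr_le (R := R) n k kn.
(* This [z] makes the outer factors [n + 1 + k] and [n + 1 - k], those of [tau_sqr_le]. *)
have := @prod_ratio_sqr_ge R (n%:R + k%:R + 2) k.
have jk j : (1 <= j < k.+1)%N -> j%:R <= k%:R :> R.
  by rewrite ler_nat => /andP[].
have z1 : n%:R + k%:R + 2 - 1 = n%:R + k%:R + 1 :> R by ring.
rewrite z1.
have P0 : 0 < \prod_(1 <= j < k.+1) (n%:R + k%:R + 2 - 2 * j%:R) :> R.
  by rewrite big_nat prodr_gt0 // => j /jk; lra.
have Q0 : 0 < \prod_(1 <= j < k.+1) (n%:R + k%:R + 1 - 2 * j%:R) :> R.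
  by rewrite big_nat prodr_gt0 // => j /jk; lra.
move: P0 Q0; set P : R := \prod_(_ <= _ < _) _; set Q : R := \prod_(_ <= _ < _) _.
move=> P0 Q0 /(_ ltac:(lra)) PQ.
have tau0 m : (k < m)%N -> 0 <= tau R m k.
  by move=> km; rewrite divr_ge0 // ltW // derivn_chebT_gt0 // ltnW.
have := tau0 n (ltnW kn); have := tau0 n.+1 (ltnW (ltnW kn)).
set s := tau R n k; set t := tau R n.+1 k => t0 s0 st.
(* If [t = 0], the quotient is [0] by the convention on inverses. *)
move: t0; rewrite le_eqVlt => /orP[/eqP <-|t0].
  by rewrite invr0 mulr0 divr_ge0 // ltW.
rewrite ler_pdivrMr // mulrAC ler_pdivlMr //.
have sQ0 : 0 <= s * Q by rewrite mulr_ge0 // ltW.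
have Pt0 : 0 <= P * t by rewrite ltW // mulr_gt0.
rewrite -ler_sqr ?nnegrE //.
rewrite -natr1 in st.
have a0 : 0 < n%:R + 1 - k%:R :> R by lra.
(* After squaring, both sides compare with [(n + 1 + k) t^2 Q^2]. *)
rewrite -(ler_pM2l a0).
have := ler_wpM2r (sqr_ge0 Q) st; have := ler_wpM2r (sqr_ge0 t) PQ; lra.
Qed.
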